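(* Fix an imprecise probability tree $(\overline{\mathrm Q}_s)_{s\in\mathscr X^\ast}$ with corresponding global upper expectation $\overline{\mathrm E}_{\mathrm V}$. For any situation $s\in\mathscr X^\ast$ and any (pointwise) non-increasing sequence $\{f_n\}_{n\in\mathbb N_0}$ of gambles on $\Omega$, with $f_n$ being $n$-measurable for every $n\in\mathbb N_0$, that converges point-wise to a variable $f\in\overline{\mathbb V}$, $$\overline{\mathrm E}_{\mathrm V}(f\vert s)=\lim_{n\to+\infty}\overline{\mathrm E}_{\mathrm V}(f_n\vert s).$$
   Context: $\overline{\mathbb R}=\mathbb R\cup\{+\infty,-\infty\}$, $\mathbb N=\{1,2,\dots\}$, $\mathbb N_0=\mathbb N\cup\{0\}$. Conventions: $+\infty-\infty=-\infty+\infty=+\infty$, $0\cdot(\pm\infty)=0$, otherwise the usual arithmetic on $\overline{\mathbb R}$. For a non-empty set $\mathscr Y$, a gamble on $\mathscr Y$ is a bounded real-valued map on $\mathscr Y$, and $\overline{\mathscr L}_b(\mathscr Y)$ is the set of all maps $f\colon\mathscr Y\to\overline{\mathbb R}$ that are bounded below (there is $M\in\mathbb R$ with $f\ge M$). An upper expectation on $\overline{\mathscr L}_b(\mathscr Y)$ is a map $\overline{\mathrm E}\colon\overline{\mathscr L}_b(\mathscr Y)\to\overline{\mathbb R}$ such that: (E1) $\overline{\mathrm E}(c)=c$ for all constants $c\in\mathbb R$; (E2) $\overline{\mathrm E}(f+g)\le\overline{\mathrm E}(f)+\overline{\mathrm E}(g)$ for all $f,g$; (E3) $\overline{\mathrm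 E}(\lambda f)=\lambda\overline{\mathrm E}(f)$ for all $\lambda\in(0,+\infty)\cup\{+\infty\}$ and all non-negative $f$; (E4) $f\le g$ implies $\overline{\mathrm E}(f)\le\overline{\mathrm E}(g)$. $\mathscr X$ is a fixed non-empty finite set (state space). A situation is a finite string $x_{1:n}=(x_1,\dots,x_n)\in\mathscr X^n$, $n\in\mathbb N_0$ (the empty string is denoted $\Box$); $\mathscr X^\ast$ is the set of all situations; $sx$ is the string $s$ followed by $x\in\mathscr X$. $\Omega=\mathscr X^{\mathbb N}$ is the set of paths; for $\omega\in\Omega$, $\omega^n$ is the string of its first $n$ entries. $\Gamma(s)$ is the set of all paths that start with the string $s$. $\overline{\mathbb V}$ is the set of all maps $\Omega\to\overline{\mathbb R}$. For $f,g\in\overline{\mathbb V}$, $f\ge_s g$ means $f(\omega)\ge g(\omega)$ for all $\omega\in\Gamma(s)$. A map $f$ on $\Omega$ is $n$-measurable if it is constant on $\Gamma(x_{1:n})$ for every $x_{1:n}\in\mathscr X^n$. An imprecise probability tree assigns to every $s\in\mathscr X^\ast$ an upper expectation $\overline{\mathrm Q}_s$ on $\overline{\mathscr L}_b(\mathscr X)$. A supermartingale (for the given tree) is a map $\mathscr M\colon\mathscr X^\ast\to\overline{\mathbb R}$ that is bounded below by a real constant and satisfies $\overline{\mathrm Q}_s(\mathscr M(s\,\cdot))\le\mathscr M(s)$ for all $s\in\mathscr X^\ast$, where $\mathscr M(s\,\cdot)(x)=\mathscr M(sx)$. $\overline{\mathbb M}_{\mathrm b}$ is the set of all supermartingales,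 and $\liminf\mathscr M(\omega):=\liminf_{n\to+\infty}\mathscr M(\omega^n)$. The global upper expectation is, for $f\in\overline{\mathbb V}$ and $s\in\mathscr X^\ast$, $$\overline{\mathrm E}_{\mathrm V}(f\vert s):=\inf\{\mathscr M(s)\colon\mathscr M\in\overline{\mathbb M}_{\mathrm b}\text{ and }\liminf\mathscr M\ge_s f\}.$$ *)

(* Defs.v *)
From mathcomp Require Import all_boot all_order all_algebra.
From mathcomp Require Import boolp classical_sets reals ereal topology normedtype
  sequences.

Set Implicit Arguments.
Unset Strict Implicit.
Unset Printing Implicit Defensive.
Import Order.TTheory GRing.Theory Num.Theory.
Import numFieldNormedType.Exports.
Local Open Scope classical_set_scope.
Local Open Scope ring_scope.

Definition bounded_below (R : realType) (Y : Type) (f : Y -> \bar R) : Prop :=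
  exists M : R, forall y, (M%:E <= f y)%E.

(* An upper expectation acts on the bounded below maps only.  Here [E] is total,
   but its values outside that domain are neither constrained nor ever used.
   The dual addition [%dE] is the one with [+oo - oo = -oo + oo = +oo]; the
   product already satisfies [0 * +oo = 0]. *)
Record upper_expectation (R : realType) (Y : Type)
    (E : (Y -> \bar R) -> \bar R) : Prop := UpperExpectation {
  uexp_cst : forall c : R, E (fun=> c%:E) = c%:E;
  uexp_subadd : forall f g : Y -> \bar R,
    bounded_below f -> bounded_below g ->
    (E (fun y => (f y + g y)%dE) <= (E f + E g)%dE)%E;
  uexp_homo : forall (l : \bar R) (f : Y -> \bar R),
    (0 < l)%E -> (forall y, 0 <= f y)%E ->
    E (fun y => (l * f y)%E) = (l * E f)%E;
  uexp_mono : forall f g : Y -> \bar R,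
    bounded_below f -> bounded_below g ->
    (forall y, f y <= g y)%E -> (E f <= E g)%E }.

Section ImpreciseTree.
Variables (R : realType) (X : finType).

Definition situation : Type := seq X.

(* The k-th state of a path [w] (counting from 1) is [w k.-1]. *)
Definition state_path : Type := nat -> X.

Definition path_prefix (w : state_path) (n : nat) : situation := mkseq w n.

Definition cylinder (s : situation) : set state_path :=
  [set w | path_prefix w (size s) = s].

Definition n_measurable (T : Type) (n : nat) (f : state_path -> T) : Prop :=
  forall s : situation, size s = n ->
    forall w w', cylinder s w -> cylinder s w' -> f w = f w'.

Definition imprecise_tree (Q : situation -> (X -> \bar R) -> \bar R) : Prop :=
  forall s, upper_expectation (Q s).

Definition supermartingale (Q : situation -> (X -> \bar R) -> \bar R)
    (M : situation -> \bar R) : Prop :=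
  bounded_below M /\
  forall s, (Q s (fun x => M (rcons s x)) <= M s)%E.

Definition liminf_path (M : situation -> \bar R) (w : state_path) : \bar R :=
  limn_einf (fun n => M (path_prefix w n)).

Definition global_upper_expectation
    (Q : situation -> (X -> \bar R) -> \bar R)
    (f : state_path -> \bar R) (s : situation) : \bar R :=
  ereal_inf [set M s | M in
    [set M | supermartingale Q M /\
             forall w, cylinder s w -> (f w <= liminf_path M w)%E]].

End ImpreciseTree.

(* Main.v *)
(* Let [M] be a supermartingale with [liminf M >=_s f], and let [e > 0].  Since
   [f_n] decreases to [f], on every path through [s] there is some [n >= |s|]
   with [f_n <= M + e] at time [n]; as [f_n] is [n]-measurable, this is a
   property of the situation reached at time [n].  These situations bar [s], so
   by compactness they are all met before some time [N].  Stopping [M + e] at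
   the first of them gives a supermartingale that is eventually constant on
   every path through [s] and dominates [f_N] there, whence
   [E(f_N | s) <= M(s) + e].  The other inequality is monotonicity. *)
Require Import Defs.
From mathcomp Require Import all_boot all_order all_algebra.
From mathcomp Require Import boolp classical_sets reals ereal topology normedtype
  sequences.

Set Implicit Arguments.
Unset Strict Implicit.
Unset Printing Implicit Defensive.
Import Order.TTheory GRing.Theory Num.Theory.
Import numFieldNormedType.Exports.
Local Open Scope classical_set_scope.
Local Open Scope ring_scope.

(** * Compactness of the set of paths *)

Section Paths.
Variable X : finType.
Implicit Types (w : state_path X) (t u : situation X) (B : pred (situation X)).

Lemma size_path_prefix w n : size (path_prefix w n) = n.
Proof. exact: size_mkseq. Qed.

Lemma path_prefixS w n : path_prefix w n.+1 = rcons (path_prefix w n) (w n).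
Proof. exact: mkseqS. Qed.

Lemma take_path_prefix w m n :
  (m <= n)%N -> take m (path_prefix w n) = path_prefix w m.
Proof.
by move=> mn; rewrite /path_prefix /mkseq -map_take take_iota (minn_idPl mn).
Qed.

Lemma cylinder_path_prefix w n : cylinder (path_prefix w n) w.
Proof. by rewrite /cylinder /= size_path_prefix. Qed.

(* Koenig's lemma: otherwise the situations below which no uniform bound exists
   form a tree without leaves, and a branch of it avoids [B]. *)
Lemma uniform_bar (x0 : X) B t :
  (forall w, cylinder t w -> exists n, B (path_prefix w n)) ->
  exists N, forall w, cylinder t w ->
    exists2 n, (n <= N)%N & B (path_prefix w n).
Proof.
move=> Bbar.
pose good u := exists N, forall w, cylinder u w ->
  exists2 n, (n <= N)%N & B (path_prefix w n).
change (good t); apply: contrapT => tbad.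
(* A bad situation has a bad child: if all children were good, the maximum of their finitely many
   bounds would serve the parent. *)
have /choice[g gP] u : exists x, ~ good u -> ~ good (rcons u x).
  apply: contrapT => /forallNP nobad.
  have ubad : ~ good u by move=> ug; apply: (nobad x0).
  have /choice[N NP] x : good (rcons u x).
    by apply: contrapT => xbad; apply: (nobad x).
  apply: ubad; exists (\max_x N x)%N => w uw.
  have [|n nN Bn] := NP (w (size u)) w.
    by rewrite /cylinder /= size_rcons path_prefixS uw.
  by exists n => //; apply: leq_trans nN (leq_bigmax _).
pose b k := iter k (fun u => rcons u (g u)) t.
have bbad k : ~ good (b k) by elim: k => [//|k IHk]; apply: gP.
have sb k : size (b k) = (size t + k)%N.
  by elim: k => [|k IHk]; rewrite ?addn0//= size_rcons IHk addnS.
have nthb k l i : (k <= l)%N -> (i < size t + k)%N ->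
    nth x0 (b l) i = nth x0 (b k) i.
  move=> /subnK <-; elim: (l - k)%N => [//|m IHm] ik.
  rewrite addSn /= nth_rcons sb -IHm// ifT//.
  by rewrite (leq_trans ik)// leq_add2l leq_addl.
(* The branch through all [b k]; as [b i.+1] has length [size t + i.+1], the default [x0] is never
   read. *)
pose w i := nth x0 (b i.+1) i.
have wb k : path_prefix w (size t + k) = b k.
  apply: (@eq_from_nth _ x0) => [|i]; rewrite size_path_prefix ?sb// => ik.
  rewrite nth_mkseq// /w; have [ki|ik'] := leqP k i.+1.
    exact: nthb.
  by rewrite -(@nthb i.+1 k) ?(ltnW ik')// addnS ltnS leq_addl.
have [|n Bn] := Bbar w; first by rewrite /cylinder /= -[size t]addn0 wb.
(* Since [b n] has length at least [n], all paths through it share with [w] the prefix that lies in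
   [B]. *)
apply: (bbad n); exists n => v; rewrite /cylinder /= => vb; exists n => //.
rewrite -(@take_path_prefix v n (size (b n))) ?sb ?leq_addl//.
by rewrite -(sb n) vb -wb take_path_prefix ?leq_addl.
Qed.

(** * Stopping at the first prefix in a set of situations *)

Section Stopping.
Variable B : pred (situation X).

Definition hits t := has (fun i => B (take i t)) (iota 0 (size t).+1).

(* When [hits t] fails, [find] returns [(size t).+1] and [stop t] is [t]. *)
Definition stop t := take (find (fun i => B (take i t)) (iota 0 (size t).+1)) t.

Lemma stopN t : ~~ hits t -> stop t = t.
Proof. by move=> /hasNfind h; rewrite /stop h size_iota take_oversize. Qed.

Lemma hits_mem t : B t -> hits t.
Proof.
move=> Bt; apply/hasP; exists (size t); last by rewrite take_size.
by rewrite mem_iota add0n leq0n ltnSn.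
Qed.

Lemma stop_mem t : hits t -> B (stop t).
Proof.
move=> ht; have := nth_find 0%N ht.
by rewrite nth_iota// -[X in (_ < X)%N](size_iota 0) -has_find.
Qed.

(** Prefixes are searched by increasing length, so a hit within [t] is found before [u] is read. *)
Lemma stop_cat t u : hits t -> stop (t ++ u) = stop t.
Proof.
rewrite /hits /stop size_cat -addSn iotaD find_cat => ht.
set a := fun i => B (take i (t ++ u)).
have eqa : {in iota 0 (size t).+1, a =1 (fun i => B (take i t))}.
  by move=> i; rewrite mem_iota /= add0n ltnS /a => it; rewrite takel_cat.
rewrite (eq_in_has eqa) ht (eq_in_find eqa) takel_cat//.
by rewrite -ltnS -[X in (_ < X)%N](size_iota 0) -has_find.
Qed.

(** No proper prefix lies in [B], so the cut falls at full length or beyond, whether or not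
    [rcons t x] is in [B]. *)
Lemma stop_rcons t x : ~~ hits t -> stop (rcons t x) = rcons t x.
Proof.
rewrite /hits /stop size_rcons -[(size t).+2]addn1 iotaD find_cat => ht.
set a := fun i => B (take i (rcons t x)).
have eqa : {in iota 0 (size t).+1, a =1 (fun i => B (take i t))}.
  by move=> i; rewrite mem_iota /= add0n ltnS /a -cats1 => it; rewrite takel_cat.
by rewrite (eq_in_has eqa) (negbTE ht) size_iota take_oversize// size_rcons leq_addr.
Qed.

Lemma stop_path w k : B (path_prefix w k) ->
  exists j, [/\ (j <= k)%N, B (path_prefix w j) &
    forall n, (k <= n)%N -> stop (path_prefix w n) = path_prefix w j].
Proof.
move=> Bk; have hk := hits_mem Bk.
pose j := size (stop (path_prefix w k)).
have jk : (j <= k)%N.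
  by rewrite /j /stop size_take size_path_prefix; case: ltnP => // /ltnW.
have stopE : stop (path_prefix w k) = path_prefix w j.
  rewrite -(take_path_prefix w jk) /j /stop size_take.
  by case: ltnP => // lek; rewrite take_size take_oversize.
exists j; split => //; first by rewrite -stopE stop_mem.
move=> n kn; rewrite -(cat_take_drop k (path_prefix w n)) take_path_prefix//.
by rewrite stop_cat.
Qed.

End Stopping.
End Paths.

(** * Stopped supermartingales *)

Section Supermartingales.
Context {R : realType} {X : finType}.
Variable Q : situation X -> (X -> \bar R) -> \bar R.
Hypothesis Q_tree : imprecise_tree Q.
Implicit Types (M : situation X -> \bar R) (f g : state_path X -> \bar R).

(** The axiom on constants covers real [c]; at [+oo] the bound is trivial. *)
Lemma upper_expectation_cst_le (Y : Type) (E : (Y -> \bar R) -> \bar R)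
  (c : \bar R) : upper_expectation E -> (-oo < c)%E -> (E (fun=> c) <= c)%E.
Proof.
by case: c => [c| |] // HE _; [rewrite uexp_cst|rewrite leey].
Qed.

Lemma upper_expectation_addr_le (Y : Type) (E : (Y -> \bar R) -> \bar R)
    (h : Y -> \bar R) (c : R) : upper_expectation E -> bounded_below h ->
  (E (fun y => h y + c%:E) <= E h + c%:E)%E.
Proof.
(* The two additions differ only on opposite infinities, and [c] is real. *)
move=> HE hb; have dE (x : \bar R) : (x + c%:E)%E = (x + c%:E)%dE by case: x.
under eq_fun do rewrite dE.
rewrite dE -[in leRHS](uexp_cst HE c); apply: uexp_subadd => //.
by exists c.
Qed.

(** After a hit the process is constant; before one, neither [t] nor its children are cut, and the
    inequality is that of [M] shifted by [c]. *)
Lemma supermartingale_stop (B : pred (situation X)) M (c : R) :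
  supermartingale Q M ->
  supermartingale Q (fun t => M (stop B t) + c%:E)%E.
Proof.
move=> [[m mM] MQ]; split.
  by exists (m + c) => t; rewrite EFinD leeD2r.
move=> t; have [ht|ht] := boolP (hits B t).
  under eq_fun do rewrite -cats1 stop_cat//.
  apply: upper_expectation_cst_le => //.
  by rewrite (@lt_le_trans _ _ (m + c)%:E) ?ltNyr// EFinD leeD2r.
under eq_fun do rewrite stop_rcons//.
rewrite (stopN ht); apply: le_trans (leeD2r _ (MQ t)).
apply: upper_expectation_addr_le => //.
by exists m.
Qed.

Lemma global_upper_expectation_mono f g s : (forall w, f w <= g w)%E ->
  (global_upper_expectation Q f s <= global_upper_expectation Q g s)%E.
Proof.
move=> fg; apply: ereal_inf_le_tmp => _ [M [MQ gM] <-]; exists M => //.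
by split => // w /gM; apply: le_trans.
Qed.

End Supermartingales.

(** * Lower limits and monotone limits *)

Section Liminf.
Context {R : realType}.
Implicit Types (u : (\bar R)^nat) (a : \bar R).

Lemma limn_einf_ge u a N :
  (forall n, (N <= n)%N -> (a <= u n)%E) -> (a <= limn_einf u)%E.
Proof.
move=> au; rewrite limn_einf_lim (cvg_lim _ (@cvg_einfs_sup _ _))//.
apply: le_ereal_sup_tmp; eexists; first by exists N.
by apply: le_ereal_inf_tmp => _ [n Nn <-]; apply: au.
Qed.

Lemma limn_einf_gt u a : (a < limn_einf u)%E ->
  exists N, forall n, (N <= n)%N -> (a < u n)%E.
Proof.
rewrite limn_einf_lim (cvg_lim _ (@cvg_einfs_sup _ _))//.
move=> /ereal_sup_gt[_ [N _ <-] aN]; exists N => n Nn.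
by apply: lt_le_trans aN _; apply: ereal_inf_lbound; exists n.
Qed.

Lemma nonincreasing_cvg_EFin (v : R^nat) (l : \bar R) : nonincreasing_seq v ->
  (v n)%:E @[n --> \oo] --> l -> l = ereal_inf (range (fun n => (v n)%:E)).
Proof.
move=> v_noninc v_cvg; apply: (cvg_unique _ v_cvg) => //.
by apply: ereal_nonincreasing_cvgn => i j ij; rewrite lee_fin v_noninc.
Qed.

(** For real [l], eventually [v] is below [l + e / 2] and [u] above [l - e / 2]. For [l = -oo], [v]
    falls below the lower bound [m] of [u]. The value [+oo] is excluded by [v 0]. *)
Lemma nonincreasing_le_limn_einf (v : R^nat) u (l : \bar R) (m e : R) (k : nat) :
  nonincreasing_seq v -> (v n)%:E @[n --> \oo] --> l ->
  (forall n, m%:E <= u n)%E -> (l <= limn_einf u)%E -> 0 < e ->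
  exists2 n, (k <= n)%N & ((v n)%:E <= u n + e%:E)%E.
Proof.
move=> v_noninc v_cvg mu lu e0.
have lE := nonincreasing_cvg_EFin v_noninc v_cvg.
have vlt (a : R) : (l < a%:E)%E -> exists N, forall n, (N <= n)%N -> v n < a.
  rewrite lE => /ereal_inf_lt[_ [N _ <-]]; rewrite lte_fin => Na.
  by exists N => n Nn; apply: le_lt_trans Na; apply: v_noninc.
case: l {v_cvg} lE lu vlt => [r| |] lE lu vlt.
- have [N1 N1P] : exists N, forall n, (N <= n)%N -> ((r - e / 2)%:E < u n)%E.
    by apply: limn_einf_gt; apply: lt_le_trans lu; rewrite lte_fin gtrBl divr_gt0.
  have [|N2 N2P] := vlt (r + e / 2); first by rewrite lte_fin ltrDl divr_gt0.
  exists (maxn k (maxn N1 N2)); first exact: leq_maxl.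
  set n := maxn _ _.
  have N1n : (N1 <= n)%N by rewrite /n !leq_max leqnn orbT.
  have N2n : (N2 <= n)%N by rewrite /n !leq_max leqnn !orbT.
  apply: le_trans (leeD2r _ (ltW (N1P _ N1n))).
  rewrite -EFinD lee_fin (le_trans (ltW (N2P _ N2n)))//.
  by rewrite [X in _ - _ + X]splitr addrA subrK.
- suff : (+oo <= (v 0)%:E)%E by rewrite leye_eq.
  by rewrite lE; apply: ereal_inf_lbound; exists 0%N.
- have [|N NP] := vlt m; first by rewrite ltNyr.
  exists (maxn k N); first exact: leq_maxl.
  apply: le_trans (leeD2r _ (mu _)); rewrite -EFinD lee_fin.
  by rewrite (le_trans (ltW (NP _ (leq_maxr _ _))))// lerDl ltW.
Qed.

End Liminf.

Theorem proposition30 (R : realType) (X : finType) (X_nonempty : (0 < #|X|)%N)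
    (Q : situation X -> (X -> \bar R) -> \bar R) (Q_tree : imprecise_tree Q)
    (s : situation X) (f_ : nat -> state_path X -> R) (f : state_path X -> \bar R)
    (f_gamble : forall n, bounded_fun (f_ n))
    (f_meas : forall n, n_measurable n (f_ n))
    (f_noninc : forall w, nonincreasing_seq (fun n => f_ n w))
    (f_cvg : forall w, (f_ n w)%:E @[n --> \oo] --> f w) :
  global_upper_expectation Q (fun w => (f_ n w)%:E) s @[n --> \oo]
    --> global_upper_expectation Q f s.
Proof.
have x0 : X by case: (fintype.pickP X) => // nX; move: X_nonempty; rewrite eq_card0.
set E := global_upper_expectation Q.
have f_le n m w : (n <= m)%N -> ((f_ m w)%:E <= (f_ n w)%:E)%E.
  by move=> nm; rewrite lee_fin f_noninc.
suff <- : ereal_inf (range (fun n => E (fun w => (f_ n w)%:E) s)) = E f s.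
  apply: ereal_nonincreasing_cvgn => i j ij.
  by apply: global_upper_expectation_mono => w; apply: f_le.
apply/eqP; rewrite eq_le; apply/andP; split; last first.
  apply: le_ereal_inf_tmp => _ [n _ <-].
  apply: global_upper_expectation_mono => w.
  rewrite (nonincreasing_cvg_EFin (f_noninc w) (f_cvg w)).
  by apply: ereal_inf_lbound; exists n.
apply: le_ereal_inf_tmp => _ [M [MQ fM] <-].
have [[m mM] _] := MQ.
apply/lee_addgt0Pr => e e0.
(* The length condition keeps the process from being stopped before [s]. *)
pose B t := (size s <= size t)%N &&
  `[< forall w, cylinder t w -> ((f_ (size t) w)%:E <= M t + e%:E)%E >].
have [|N NP] := @uniform_bar X x0 B s.
  move=> w /fM fMw.
  have [n sn fn] := nonincreasing_le_limn_einf (size s) (f_noninc w) (f_cvg w)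
    (fun n => mM (path_prefix w n)) fMw e0.
  exists n; rewrite /B size_path_prefix sn /=; apply/asboolP => v vw.
  by rewrite (f_meas _ _ (size_path_prefix w n) _ _ vw (@cylinder_path_prefix _ w n)).
apply: ge_ereal_inf; eexists; first by exists N.
apply: ge_ereal_inf; exists (M (stop B s) + e%:E)%E.
  exists (fun t => M (stop B t) + e%:E)%E => //; split.
    exact: supermartingale_stop.
  move=> w sw; have [k kN Bk] := NP w sw.
  have [j [jk Bj stopj]] := stop_path Bk.
  (* From time [k] on the process is frozen at time [j]; as [j <= k <= N], [f_ N] is below [f_ j],
     which [B] bounds. *)
  apply: (@limn_einf_ge _ _ _ k) => n kn; rewrite stopj//.
  move: Bj => /andP[_ /asboolP/(_ w (@cylinder_path_prefix _ w j))].
  by rewrite size_path_prefix; apply/le_trans/f_le/(leq_trans jk).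
rewrite leeD2r//.
(* The only prefix of [s] long enough to lie in [B] is [s] itself, so [stop B s] is [s] in either
   case. *)
have [hs|hs] := boolP (hits B s); last by rewrite stopN.
have /andP[ss _] := stop_mem hs.
have sN : (size s <= find (fun i => B (take i s)) (iota 0 (size s).+1))%N.
  rewrite leqNgt; apply/negP => lt_s.
  by move: ss; rewrite /stop size_take lt_s leqNgt lt_s.
by rewrite /stop take_oversize.
Qed.
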